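(* Let $\mathcal{B}$ be a finite relational structure and let $r\in(0,1]$. If \textsc{Max-CSP}$(\mathcal{B})$ is polynomial-time $r$-approximable, then for every $\epsilon>0$, \textsc{Max-Sur-CSP}$(\mathcal{B})$ is polynomial-time $(r-\epsilon)$-approximable.
   Context: For a finite relational signature $\sigma$ with relation symbols $R_1,\dots,R_m$ of arities $k_1,\dots,k_m$, a finite $\sigma$-structure $\mathcal{A}=(A,R_1^{\mathcal{A}},\dots,R_m^{\mathcal{A}})$ consists of a finite set $A$ and relations $R_i^{\mathcal{A}}\subseteq A^{k_i}$; its size is $|\mathcal{A}|=|A|+\sum_i|R_i^{\mathcal{A}}|$. For a fixed finite $\sigma$-structure $\mathcal{B}$, \textsc{Max-CSP}$(\mathcal{B})$ takes as input a finite $\sigma$-structure $\mathcal{A}$ and asks for a function $h:A\to B$ maximizing the number of pairs $(i,(a_1,\dots,a_{k_i}))$ with $(a_1,\dots,a_{k_i})\in R_i^{\mathcal{A}}$ and $(h(a_1),\dots,h(a_{k_i}))\in R_i^{\mathcal{B}}$. \textsc{Max-Sur-CSP}$(\mathcal{B})$ is the same problem restricted to instances with $|A|\geq|B|$ and requiring $h$ to be surjective. A solution with value $Val$ is $r$-approximate if $Val/Opt\geq r$, where $Opt$ is the optimum. A problem is polynomial-time $r$-approximable if some deterministic algorithm running in time polynomial in $|\mathcal{A}|$ outputs an $r$-approximate solution on every instance. *)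

(* Defs.v *)
From HB Require Import structures.
From mathcomp Require Import all_boot all_order all_algebra.
From mathcomp Require Import reals.

Set Implicit Arguments.
Unset Strict Implicit.
Unset Printing Implicit Defensive.

Record signature := Signature {
  nrel : nat;
  arity : 'I_nrel -> nat
}.

Record fin_structure (s : signature) := FinStructure {
  univ :> finType;
  interp : forall i : 'I_(nrel s), {set (arity i).-tuple univ}
}.

Definition struct_size (s : signature) (A : fin_structure s) : nat :=
  #|A| + \sum_(i < nrel s) #|interp A i|.

Definition csp_value (s : signature) (A B : fin_structure s)
    (h : {ffun A -> B}) : nat :=
  \sum_(i < nrel s)
    #|[set t in interp A i | map_tuple h t \in interp B i]|.

(* A maximization problem with the objective [csp_value]: the admissible input
   structures, and the admissible maps for each input. *)
Record map_problem (s : signature) (B : fin_structure s) := MapProblem {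
  instance : fin_structure s -> Prop;
  solution : forall A : fin_structure s, pred {ffun A -> B}
}.

Definition max_csp (s : signature) (B : fin_structure s) : map_problem B :=
  MapProblem (fun _ => True) (fun _ => predT).

Definition max_sur_csp (s : signature) (B : fin_structure s) : map_problem B :=
  MapProblem (fun A : fin_structure s => #|B| <= #|A|)
             (fun A (h : {ffun A -> B}) => [forall b, exists a, h a == b]).

Definition opt (s : signature) (B : fin_structure s) (P : map_problem B)
    (A : fin_structure s) : nat :=
  \max_(h : {ffun A -> B} | solution P h) csp_value h.

(* If the optimum is 0, the ratio is undefined and every solution, being
   optimal, counts as r-approximate. *)
Definition approx_solution (R : realType) (s : signature) (B : fin_structure s)
    (P : map_problem B) (r : R) (A : fin_structure s) (h : {ffun A -> B})
    : Prop :=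
  solution P h /\
  (0 < opt P A -> (r <= (csp_value h)%:R / (opt P A)%:R)%R).

(* Deterministic multi-tape Turing machines over the alphabet {0, 1, blank};
   the blank is [None]. *)

Inductive move := MoveL | MoveR | Stay.

Definition symbol := option bool.

(* A tape unbounded in both directions: the cells left of the head, nearest
   first, and the cells from the scanned one rightwards. All cells beyond the
   ends of the two sequences are blank. *)
Record tape := Tape { tleft : seq symbol; tright : seq symbol }.

Definition tape_read (t : tape) : symbol := head None (tright t).

Definition tape_write (a : symbol) (t : tape) : tape :=
  Tape (tleft t) (a :: behead (tright t)).

Definition tape_move (m : move) (t : tape) : tape :=
  match m with
  | MoveL => Tape (behead (tleft t)) (head None (tleft t) :: tright t)
  | MoveR => Tape (tape_read t :: tleft t) (behead (tright t))
  | Stay => t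
  end.

(* There are [nwork.+1] tapes, tape [ord0] serving for input and output. The
   machine halts when [delta] returns [None]; otherwise [delta] gives the next
   state and, for each tape, the symbol to write and the move to make. *)
Record TM := MkTM {
  nwork : nat;
  state : finType;
  start : state;
  delta : state -> {ffun 'I_nwork.+1 -> symbol} ->
          option (state * {ffun 'I_nwork.+1 -> symbol * move})
}.

Record config (M : TM) := Config {
  cstate : state M;
  ctapes : {ffun 'I_(nwork M).+1 -> tape}
}.

Definition step (M : TM) (c : config M) : option (config M) :=
  match delta (cstate c) [ffun j => tape_read (ctapes c j)] with
  | None => None
  | Some (q, act) =>
      Some (Config q [ffun j => tape_move (act j).2
                                  (tape_write (act j).1 (ctapes c j))])
  end.

(* [run n c] is the halting configuration reached from [c], if it is reached in
   at most [n] steps, and [None] otherwise. *)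
Fixpoint run (M : TM) (n : nat) (c : config M) : option (config M) :=
  match step c with
  | None => Some c
  | Some c' => if n is n'.+1 then run n' c' else None
  end.

Definition init_config (M : TM) (w : seq bool) : config M :=
  Config (start M)
    [ffun j => if j == ord0 then Tape [::] (map Some w) else Tape [::] [::]].

Fixpoint nonblank_prefix (u : seq symbol) : seq bool :=
  if u is Some b :: u' then b :: nonblank_prefix u' else [::].

(* The output is the word on tape [ord0] from the head up to the next blank. *)
Definition output (M : TM) (c : config M) : seq bool :=
  nonblank_prefix (tright (ctapes c ord0)).

Definition enc_nat (n : nat) : seq bool := rcons (nseq n true) false.

(* Elements of a finite type are named by their rank in its enumeration. *)
Definition enc_elt (T : finType) (x : T) : seq bool := enc_nat (enum_rank x).

(* The list of the tuples in the relation: each one is preceded by the bit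
   [true], and the bit [false] closes the list. *)
Definition enc_rel (s : signature) (A : fin_structure s) (i : 'I_(nrel s))
    : seq bool :=
  rcons (flatten [seq true :: flatten [seq enc_elt a | a <- tval t]
                 | t <- enum (interp A i)]) false.

Definition enc_struct (s : signature) (A : fin_structure s) : seq bool :=
  enc_nat #|A| ++ flatten [seq enc_rel A i | i <- enum 'I_(nrel s)].

Definition enc_map (s : signature) (A B : fin_structure s) (h : {ffun A -> B})
    : seq bool :=
  flatten [seq enc_elt (h a) | a <- enum A].

(* The lengths of the unary-based codes above are polynomially bounded in
   [struct_size A] for a fixed signature and a fixed [B]. *)
Definition poly_time_approximable (R : realType) (s : signature)
    (B : fin_structure s) (P : map_problem B) (r : R) : Prop :=
  exists (M : TM) (c d : nat), forall A : fin_structure s, instance P A ->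
    exists (h : {ffun A -> B}) (f : config M),
      [/\ run (c * struct_size A ^ d + c) (init_config M (enc_struct A)) = Some f,
          output f = enc_map h
        & approx_solution P r h].

(* Main.v *)
Require Import Defs.
From HB Require Import structures.
From mathcomp Require Import all_boot all_order all_algebra.
From mathcomp Require Import reals boolp zify ring lra.

Set Implicit Arguments.
Unset Strict Implicit.
Unset Printing Implicit Defensive.

(* Let [h] be an [r]-approximate solution of Max-CSP and [K] the maximal arity.
   Take [N > K / e] disjoint blocks of [#|B|] elements of [A]; for each block,
   redefine [h] on it as a bijection onto [B], which makes [h] surjective. A
   tuple satisfied by [h] meets at most [K] blocks, so on average such a patch
   loses at most a fraction [K / N < e] of the value of [h], and the best one is
   [(r - e)]-approximate. If [A] has at most [L = N * #|B|] elements, there may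
   be too few blocks, but then every surjection is a patch of [h] on the first
   [L] elements.
   In both cases it suffices to return the best patch of [h] on the first [L]
   elements that is onto [B]. There is a constant number of such patches, so one
   machine can simulate the given one on a copy of the input to get [h], then
   scan the input once and evaluate all patches in parallel, with a unary
   counter on a separate tape for each patch. *)

Local Open Scope int_scope.
Local Open Scope nat_scope.

Lemma PoszS k : k.+1%:Z = (k%:Z + 1)%R.
Proof. by rewrite -addn1 PoszD. Qed.

(** * Tapes with absolute head positions *)

(** Contents and head position are kept apart, so that a move leaves the contents fixed and phases
    can be stated about functions on the integers. *)
Definition atape := ((int -> symbol) * int)%type.

Definition aread (t : atape) : symbol := t.1 t.2.
Arguments aread _ : simpl never.

Lemma areadE f p : aread (f, p) = f p.
Proof. by []. Qed.

Definition upd (f : int -> symbol) (p : int) (a : symbol) : int -> symbol :=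
  fun i => if i == p then a else f i.

(* [None] leaves the scanned cell unchanged. *)
Definition action := (option symbol * move)%type.

Definition shift (m : move) (p : int) : int :=
  match m with MoveL => p - 1 | MoveR => p + 1 | Stay => p end%R.

Definition act_tape (a : action) (t : atape) : atape :=
  (if a.1 is Some x then upd t.1 t.2 x else t.1, shift a.2 t.2).

Definition cell (t : tape) (i : int) : symbol :=
  match i with
  | Posz k => nth None (tright t) k
  | Negz k => nth None (tleft t) k
  end.

(** [cell] counts from the head, [u] from a fixed origin. Sequences that differ only in trailing
    blanks represent the same [u]. *)
Definition rep (t : tape) (u : atape) : Prop :=
  forall i, cell t i = u.1 (u.2 + i)%R.

Lemma cell_write a t i :
  cell (tape_write a t) i = if i == 0%R then a else cell t i.
Proof. by case: i => [[|k]|k] //=; rewrite nth_behead. Qed.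

Lemma cell_move m t i : cell (tape_move m t) i = cell t (shift m i).
Proof.
by case: m; case: i => [[|k]|[|k]] //=; rewrite ?nth_behead ?subn1 ?addn0 ?addn1.
Qed.

Lemma rep_read t u : rep t u -> tape_read t = aread u.
Proof.
by move=> /(_ 0%R); rewrite GRing.addr0 /aread => <-; rewrite /tape_read /=; case: (tright t).
Qed.

Lemma rep_act a t u :
  rep t u ->
  rep (tape_move a.2 (tape_write (odflt (tape_read t) a.1) t)) (act_tape a u).
Proof.
move=> r i; rewrite cell_move cell_write (rep_read r) r /act_tape /=.
have -> : (shift a.2 u.2 + i = u.2 + shift a.2 i)%R by case: a.2 => /=; lia.
have -> : (shift a.2 i == 0)%R = (u.2 + shift a.2 i == u.2)%R by lia.
case: a.1 => [x|] //=; rewrite /upd //.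
by case: eqP => // ->.
Qed.

Fixpoint word_at (f : int -> symbol) (p : int) (w : seq bool) : Prop :=
  if w is b :: w' then f p = Some b /\ word_at f (p + 1)%R w' else True.

Lemma word_at_cat f p v w :
  word_at f p (v ++ w) <-> word_at f p v /\ word_at f (p + (size v)%:Z)%R w.
Proof.
elim: v p => [|b v IH] p /=; first by rewrite GRing.addr0; tauto.
rewrite IH (_ : (p + 1 + (size v)%:Z = p + (size v).+1%:Z)%R); first by tauto.
lia.
Qed.

Lemma word_at_nth f p w k : word_at f p w -> k < size w ->
  f (p + k%:Z)%R = Some (nth false w k).
Proof.
elim: w p k => [|b w IH] p [|k] //= [fp fw] kw; first by rewrite GRing.addr0.
rewrite -(IH (p + 1)%R) //; congr f; lia.
Qed.

Lemma word_at_offset f g p q v :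
  (forall k, k < size v -> f (p + k%:Z)%R = g (q + k%:Z)%R) ->
  word_at f p v -> word_at g q v.
Proof.
elim: v p q => //= x v IH p q fg [fp fv]; split.
  by have := fg 0 isT; rewrite !GRing.addr0 => <-.
apply: IH fv => k kv; have := fg k.+1 kv.
by rewrite PoszS !(GRing.addrC k%:Z) !GRing.addrA.
Qed.

Lemma rep_output t u w : rep t u -> word_at u.1 u.2 w ->
  u.1 (u.2 + (size w)%:Z)%R = None -> nonblank_prefix (tright t) = w.
Proof.
case: u => f p /= r; have {r}: forall k, nth None (tright t) k = f (p + k%:Z)%R.
  by move=> k; exact: (r k).
move: (tright t) => s.
elim: w s p => [|b w IH] s p fs /=.
  by move=> _; rewrite -fs; case: s {fs} => [|a s] //= ->.
case=> fp fw fe; have := fs 0; rewrite GRing.addr0 fp.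
case: s fs => //= a s fs ->; rewrite (IH _ (p + 1)%R) //.
- by move=> k; rewrite -(GRing.addrA p) -(fs k.+1).
- by rewrite -fe; congr f; lia.
Qed.

Lemma output_word t u : rep t u -> word_at u.1 u.2 (nonblank_prefix (tright t))
  /\ u.1 (u.2 + (size (nonblank_prefix (tright t)))%:Z)%R = None.
Proof.
case: u => f p /= r; have {r}: forall k, nth None (tright t) k = f (p + k%:Z)%R.
  by move=> k; exact: (r k).
move: (tright t) => s.
elim: s p => [|[b|] s IH] p fs /=; try by have := fs 0.
have [|fw fe] := IH (p + 1)%R; first by move=> k; have /= -> := fs k.+1; congr f; lia.
split; last by rewrite -fe; congr f; lia.
by split=> //; have := fs 0; rewrite GRing.addr0.
Qed.

Definition word_tape (w : seq bool) (i : int) : symbol :=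
  if i is Posz k then nth None (map Some w) k else None.

Definition blank_tape : atape := (fun=> None, 0%R).

Lemma rep_word w : rep (Tape [::] (map Some w)) (word_tape w, 0%R).
Proof. by move=> [k|k] //=; rewrite nth_nil. Qed.

Lemma rep_blank : rep (Tape [::] [::]) blank_tape.
Proof. by move=> [k|k] /=; rewrite nth_nil. Qed.

Lemma word_tape_at w : word_at (word_tape w) 0 w.
Proof.
suff H k : k <= size w -> word_at (word_tape w) k%:Z (drop k w).
  by have := H 0 isT; rewrite drop0.
move=> /subnKC; move: (_ - _) => d; elim: d k => [|d IH] k kd.
  by rewrite drop_oversize //; lia.
rewrite (drop_nth false); last lia.
split; first by rewrite /= (nth_map false) //; lia.
by rewrite -PoszD addn1; apply: IH; lia.
Qed.

Lemma word_tape_out w (i : int) : (i < 0)%R || ((size w)%:Z <= i)%R ->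
  word_tape w i = None.
Proof. by case: i => k //= h; rewrite nth_default // size_map; lia. Qed.

(** * Machines over an arbitrary finite set of tapes *)

(* The input and output tape is [None], the work tapes are [Some _]. *)
Record amachine := AMachine {
  atix : finType;
  astate : finType;
  astart : astate;
  atrans : astate -> (option atix -> symbol) ->
           option (astate * (option atix -> action))
}.

Section AbstractMachine.

Variable N : amachine.

Definition aconf := (astate N * (option (atix N) -> atape))%type.

Definition astep (c : aconf) : option aconf :=
  if atrans c.1 (fun x => aread (c.2 x)) is Some (q, a)
  then Some (q, fun x => act_tape (a x) (c.2 x)) else None.

(** The index bounds the number of steps instead of counting them, so that phases compose with rough
    time bounds. *)
Inductive reach : nat -> aconf -> aconf -> Prop :=
| reach_refl n c : reach n c c
| reach_step n c1 c2 c3 : astep c1 = Some c2 -> reach n c2 c3 ->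
    reach n.+1 c1 c3.

Lemma reach_leq m n c1 c2 : m <= n -> reach m c1 c2 -> reach n c1 c2.
Proof.
move=> + r; elim: r n => [? c|? a b d ab _ IH] [|n] //; try by left.
by move=> mn; apply: reach_step ab (IH _ mn).
Qed.

Lemma reach_trans m n c1 c2 c3 :
  reach m c1 c2 -> reach n c2 c3 -> reach (m + n) c1 c3.
Proof.
elim=> [k c|k a b d ab _ IH] r; first by apply: reach_leq r; apply: leq_addl.
by rewrite addSn; apply: reach_step ab (IH r).
Qed.

Definition tape_of_ix (x : option (atix N)) : 'I_#|atix N|.+1 :=
  if x is Some y then lift ord0 (enum_rank y) else ord0.

Definition ix_of_tape (j : 'I_#|atix N|.+1) : option (atix N) :=
  omap enum_val (unlift ord0 j).

Lemma tape_of_ixK : cancel tape_of_ix ix_of_tape.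
Proof.
by case=> [y|]; rewrite /ix_of_tape /= ?liftK /= ?enum_rankK // unlift_none.
Qed.

(** A [TM] writes on every tape at each step, so an action without a symbol rewrites the scanned
    one. *)
Definition TM_of_amachine : TM :=
  MkTM (astart N)
    (fun q (r : {ffun 'I_#|atix N|.+1 -> symbol}) =>
       if atrans q (fun x => r (tape_of_ix x)) is Some (q', a)
       then Some (q', [ffun j => (odflt (r j) (a (ix_of_tape j)).1,
                                  (a (ix_of_tape j)).2)])
       else None).

Definition crep (c : config TM_of_amachine) (a : aconf) : Prop :=
  cstate c = a.1 /\ forall x, rep (ctapes c (tape_of_ix x)) (a.2 x).

(** The transition depends only on the symbols read, and these agree by [rep_read]. The match also
    ensures that both machines halt together. *)
Lemma crep_step c a : crep c a ->
  match step c, astep a with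
  | None, None => True
  | Some c', Some a' => crep c' a'
  | _, _ => False
  end.
Proof.
case: c a => q T [q' U] [/= -> rT]; rewrite /step /astep /=.
rewrite (_ : (fun x => _) = fun x => aread (U x)); last first.
  by apply: funext => x; rewrite ffunE (rep_read (rT x)).
case: atrans => // -[q'' a]; split => //= x.
by rewrite !ffunE /= tape_of_ixK; apply: rep_act.
Qed.

Lemma run_reach n c a a' : crep c a -> reach n a a' -> astep a' = None ->
  exists2 f, run n c = Some f & crep f a'.
Proof.
move=> + r; elim: r c => [{}n b|{}n b1 b2 b3 st _ IH] c ca halt.
  have := crep_step ca; rewrite halt; case E: (step c) => // _.
  by exists c => //; case: n => [|n] /=; rewrite E.
have := crep_step ca; rewrite st; case E: (step c) => [c'|//] ca'.
by have [f fE fr] := IH _ ca' halt; exists f => //=; rewrite E.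
Qed.

Definition init_aconf (w : seq bool) : aconf :=
  (astart N, fun x => if x is Some _ then blank_tape else (word_tape w, 0%R)).

Lemma crep_init w : crep (init_config TM_of_amachine w) (init_aconf w).
Proof.
split=> // -[y|] /=; rewrite ffunE; first by rewrite /=; apply: rep_blank.
by rewrite eqxx; apply: rep_word.
Qed.

Lemma TM_of_amachine_run n w v a : reach n (init_aconf w) a -> astep a = None ->
  word_at (a.2 None).1 (a.2 None).2 v ->
  (a.2 None).1 ((a.2 None).2 + (size v)%:Z)%R = None ->
  exists2 f, run n (init_config TM_of_amachine w) = Some f & output f = v.
Proof.
move=> r halt wv we; have [f fE [_ fr]] := run_reach (crep_init w) r halt.
by exists f => //; apply: rep_output (fr None) _ _.
Qed.

End AbstractMachine.

(** * The approximation machine *)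

(* The patch [phi] overrides the value [b] of the element of rank [k], when
   [k < L] and [phi k] is not [None]. *)
Definition overwrite (T : Type) (L : nat) (phi : {ffun 'I_L -> option T})
    (b : T) (k : nat) : T :=
  if insub k is Some i then odflt b (phi i) else b.

(** Patches act only on ranks below [L], so finitely many states suffice to remember ranks. *)
Lemma overwrite_minn T L (phi : {ffun 'I_L -> option T}) b k :
  overwrite phi b (minn k L) = overwrite phi b k.
Proof.
have [//|Lk] := ltnP k L.
by rewrite /overwrite !insubN // -leqNgt.
Qed.

Definition covers (T : finType) (L : nat) (n : nat)
    (phi : {ffun 'I_L -> option T}) : bool :=
  [forall b, exists i : 'I_L, (i < n) && (phi i == Some b)].

(** Likewise, the size of the input truncated at [L] suffices to recognise the covering patches. *)
Lemma covers_minn (T : finType) L n (phi : {ffun 'I_L -> option T}) :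
  covers (minn n L) phi = covers n phi.
Proof.
by apply: eq_forallb => b; apply: eq_existsb => i; rewrite leq_min ltn_ord andbT.
Qed.

Definition max_arity (s : signature) : nat := \max_(i < nrel s) arity i.

Section States.

Variables (s : signature) (B : fin_structure s) (M : TM) (L : nat).

(** The bound on the length keeps the set of states finite. An entry holds the value of [h] at an
    element and the truncated rank of that element. *)
Definition scanned := {bseq (max_arity s) of B * 'I_L.+1}.

(* [Sim q] simulates [M]; [Extract k] has read [k] bits [true] of the code of a
   value of [h]; [RewindH] brings the tapes holding [h] back to their origin, and
   then resumes reading the given tuple. The first ['I_L.+1] is the size of the
   input structure and the last one in [Elt] the rank being read, both truncated
   at [L]. *)
Inductive pc :=
| Copy
| Rewind
| Sim of state M
| Extract of 'I_#|B|.+1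
| RewindH of option ('I_L.+1 * 'I_(nrel s) * scanned)
| Head of 'I_L.+1
| Rel of 'I_L.+1 & option 'I_(nrel s)
| Next of 'I_L.+1 & 'I_(nrel s) & scanned
| Elt of 'I_L.+1 & 'I_(nrel s) & scanned & 'I_L.+1
| Cmp of 'I_L.+1 & {ffun 'I_L -> option B}
| Out of {ffun 'I_L -> option B} & 'I_L.+1
| Put of {ffun 'I_L -> option B} & 'I_L.+1 & 'I_#|B|.+1
| Back
| Halt.

(** A finite type into which the states embed, from which [pc] gets its finite structure; ['I_4]
    names the four states without parameters. *)
Definition pc_code : Type :=
  'I_4 + state M + 'I_#|B|.+1 + option ('I_L.+1 * 'I_(nrel s) * scanned) +
  'I_L.+1 + 'I_L.+1 * option 'I_(nrel s) + 'I_L.+1 * 'I_(nrel s) * scanned +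
  'I_L.+1 * 'I_(nrel s) * scanned * 'I_L.+1 +
  'I_L.+1 * {ffun 'I_L -> option B} + {ffun 'I_L -> option B} * 'I_L.+1 +
  {ffun 'I_L -> option B} * 'I_L.+1 * 'I_#|B|.+1.

Definition encode_pc (q : pc) : pc_code :=
  match q with
  | Copy => inl (inl (inl (inl (inl (inl (inl (inl (inl (inl (inord 0))))))))))
  | Rewind => inl (inl (inl (inl (inl (inl (inl (inl (inl (inl (inord 1))))))))))
  | Back => inl (inl (inl (inl (inl (inl (inl (inl (inl (inl (inord 2))))))))))
  | Halt => inl (inl (inl (inl (inl (inl (inl (inl (inl (inl (inord 3))))))))))
  | Sim q => inl (inl (inl (inl (inl (inl (inl (inl (inl (inr q)))))))))
  | Extract k => inl (inl (inl (inl (inl (inl (inl (inl (inr k))))))))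
  | RewindH x => inl (inl (inl (inl (inl (inl (inl (inr x)))))))
  | Head c => inl (inl (inl (inl (inl (inl (inr c))))))
  | Rel m i => inl (inl (inl (inl (inl (inr (m, i))))))
  | Next m i t => inl (inl (inl (inl (inr (m, i, t)))))
  | Elt m i t c => inl (inl (inl (inr (m, i, t, c))))
  | Cmp m phi => inl (inl (inr (m, phi)))
  | Out phi c => inl (inr (phi, c))
  | Put phi c k => inr (phi, c, k)
  end.

Definition decode_pc (x : pc_code) : pc :=
  match x with
  | inl (inl (inl (inl (inl (inl (inl (inl (inl (inl k))))))))) =>
    nth Halt [:: Copy; Rewind; Back; Halt] k
  | inl (inl (inl (inl (inl (inl (inl (inl (inl (inr q))))))))) => Sim q
  | inl (inl (inl (inl (inl (inl (inl (inl (inr k)))))))) => Extract k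
  | inl (inl (inl (inl (inl (inl (inl (inr x))))))) => RewindH x
  | inl (inl (inl (inl (inl (inl (inr c)))))) => Head c
  | inl (inl (inl (inl (inl (inr (m, i)))))) => Rel m i
  | inl (inl (inl (inl (inr (m, i, t))))) => Next m i t
  | inl (inl (inl (inr (m, i, t, c)))) => Elt m i t c
  | inl (inl (inr (m, phi))) => Cmp m phi
  | inl (inr (phi, c)) => Out phi c
  | inr (phi, c, k) => Put phi c k
  end.

Lemma encode_pcK : cancel encode_pc decode_pc.
Proof. by case=> //=; rewrite inordK. Qed.

HB.instance Definition _ := Finite.copy pc (can_type encode_pcK).

End States.

Arguments Copy {s B M L}.
Arguments Rewind {s B M L}.
Arguments Sim {s B M L} _.
Arguments Extract {s B M L} _.
Arguments RewindH {s B M L} _.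
Arguments Head {s B M L} _.
Arguments Rel {s B M L} _ _.
Arguments Next {s B M L} _ _ _.
Arguments Elt {s B M L} _ _ _ _.
Arguments Cmp {s B M L} _ _.
Arguments Out {s B M L} _ _.
Arguments Put {s B M L} _ _ _.
Arguments Back {s B M L}.
Arguments Halt {s B M L}.

Section Machine.

Variables (s : signature) (B : fin_structure s) (M : TM) (L : nat) (b0 : B).

Local Notation patch := {ffun 'I_L -> option B}.
Local Notation pc := (pc B M L).
Local Notation scanned := (scanned B L).

Definition work := ('I_(nwork M).+1 + (B + patch))%type.

Definition assemble (T : Type) (i : T) (m : 'I_(nwork M).+1 -> T) (h : B -> T)
    (c : patch -> T) (x : option work) : T :=
  match x with
  | None => i
  | Some (inl j) => m j
  | Some (inr (inl b)) => h b
  | Some (inr (inr phi)) => c phi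
  end.

Definition go (m : move) : action := (None, m).
Definition put (b : bool) (m : move) : action := (Some (Some b), m).
Definition only (a : action) (j : 'I_(nwork M).+1) : action :=
  if j == ord0 then a else go Stay.

Definition cap (k : nat) : 'I_L.+1 := inord (minn k L).

Lemma capE k : cap k = minn k L :> nat.
Proof. by rewrite inordK // ltnS geq_minr. Qed.

Lemma capS k : cap (cap k).+1 = cap k.+1.
Proof. by apply: val_inj; rewrite /= !capE; lia. Qed.

(** The scanned tuple is a plain sequence, so membership goes through a tuple [u] with the same
    entries. *)
Definition counted (i : 'I_(nrel s)) (t : seq (B * 'I_L.+1)) (phi : patch) : bool :=
  [exists u in interp B i, tval u == [seq overwrite phi x.1 x.2 | x : B * 'I_L.+1 <- t]].

(* The work tapes are those of [M], one tape for each [b : B], which marks the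
   elements mapped to [b] by [h], and one counter for each patch. *)
Definition trans (q : pc) (rd : option work -> symbol) :
    option (pc * (option work -> action)) :=
  let stay {T : Type} (x : T) := go Stay in
  let x := rd None in
  let y := rd (Some (inl ord0)) in
  let hd b := rd (Some (inr (inl b))) in
  let here := odflt b0 [pick b | hd b == Some true] in
  let ct phi := rd (Some (inr (inr phi))) in
  match q with
  | Copy =>
    if x is Some b
    then Some (Copy, assemble (go MoveR) (only (put b MoveR)) stay stay)
    else Some (Rewind, assemble (go MoveL) (only (go MoveL)) stay stay)
  | Rewind =>
    if x is Some b
    then Some (Rewind, assemble (go MoveL) (only (go MoveL)) stay stay)
    else Some (Sim (start M), assemble (go MoveR) (only (go MoveR)) stay stay)
  | Sim q =>
    if delta q [ffun j => rd (Some (inl j))] is Some (q', a)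
    then Some (Sim q', assemble (go Stay) (fun j => (Some (a j).1, (a j).2)) stay stay)
    else Some (Extract ord0, assemble (go Stay) stay stay stay)
  | Extract k =>
    match y with
    | Some true => Some (Extract (inord k.+1),
                         assemble (go Stay) (only (go MoveR)) stay stay)
    | Some false => Some (Extract ord0,
                          assemble (go Stay) (only (go MoveR))
                            (fun b => put (enum_rank b == k :> nat) MoveR) stay)
    | None => Some (RewindH None,
                    assemble (go Stay) stay (fun=> go MoveL) stay)
    end
  | RewindH r =>
    if hd b0 is Some _
    then Some (RewindH r, assemble (go Stay) stay (fun=> go MoveL) stay)
    else Some (if r is Some (m, i, t) then Next m i t else Head ord0,
               assemble (go Stay) stay (fun=> go MoveR) stay)
  | Head c =>
    match x with
    | Some true => Some (Head (cap c.+1), assemble (go MoveR) stay stay stay)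
    | Some false => Some (Rel c (insub 0), assemble (go MoveR) stay stay stay)
    | None => None
    end
  | Rel m (Some i) =>
    match x with
    | Some true => Some (Next m i [bseq], assemble (go MoveR) stay stay stay)
    | Some false => Some (Rel m (insub i.+1), assemble (go MoveR) stay stay stay)
    | None => None
    end
  | Rel m None =>
    Some (Cmp m (odflt [ffun=> None] [pick phi | covers m phi]),
          assemble (go Stay) stay stay (fun=> go MoveL))
  | Next m i t =>
    if size t == arity i
    then Some (Rel m (Some i), assemble (go Stay) stay stay
                 (fun phi => if counted i t phi then put true MoveR else go Stay))
    else Some (Elt m i t ord0, assemble (go Stay) stay stay stay)
  | Elt m i t c =>
    match x with
    | Some true => Some (Elt m i t (cap c.+1),
                         assemble (go MoveR) stay (fun=> go MoveR) stay)
    | Some false => Some (RewindH (Some (m, i, insub_bseq _ (rcons t (here, c)))),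
                          assemble (go MoveR) stay (fun=> go MoveL) stay)
    | None => None
    end
  | Cmp m phi =>
    if [pick psi | covers m psi && (ct psi == Some true)] is Some psi
    then Some (Cmp m psi, assemble (go Stay) stay stay (fun=> go MoveL))
    else Some (Out phi ord0, assemble (go MoveR) stay stay stay)
  | Out phi c =>
    if hd b0 is Some _
    then Some (Put phi c (inord (enum_rank (overwrite phi here c))),
               assemble (go Stay) stay stay stay)
    else Some (Back, assemble (go MoveL) stay stay stay)
  | Put phi c k =>
    if k == 0 :> nat
    then Some (Out phi (cap c.+1),
               assemble (put false MoveR) stay (fun=> go MoveR) stay)
    else Some (Put phi c (inord k.-1), assemble (put true MoveR) stay stay stay)
  | Back =>
    if x is Some _
    then Some (Back, assemble (go MoveL) stay stay stay)
    else Some (Halt, assemble (go MoveR) stay stay stay)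
  | Halt => None
  end.

Definition machine : amachine := AMachine (Copy : pc) trans.

End Machine.

Lemma upd_word_tape v x :
  upd (word_tape v) (size v)%:Z (Some x) = word_tape (rcons v x).
Proof.
apply: funext => -[k|k]; rewrite /upd //= map_rcons nth_rcons size_map eqz_nat.
by case: ltngtP => // h; rewrite nth_default ?size_map // ltnW.
Qed.

Lemma word_tape_nth w k : k < size w -> word_tape w k%:Z = Some (nth false w k).
Proof. by move=> kw; rewrite /= (nth_map false). Qed.

(** * Phases of a run *)

Section Run.

Variables (s : signature) (B : fin_structure s) (M : TM) (L : nat) (b0 : B).

Local Notation patch := {ffun 'I_L -> option B}.
Local Notation N := (machine M L b0).
Local Notation reach := (@reach N).

Definition conf q i m h c : aconf N := (q, assemble i m h c).

(** One step is checked separately on the four groups of tapes; the rest of the run is the last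
    premise, once the others have determined the new tapes. *)
Lemma conf_step n q i m h c ai am ah ac q' i' m' h' c' a2 :
  trans b0 q (fun x => aread (assemble i m h c x)) =
    Some (q', assemble ai am ah ac) ->
  act_tape ai i = i' ->
  (forall j, act_tape (am j) (m j) = m' j) ->
  (forall b, act_tape (ah b) (h b) = h' b) ->
  (forall phi, act_tape (ac phi) (c phi) = c' phi) ->
  reach n (conf q' i' m' h' c') a2 -> reach n.+1 (conf q i m h c) a2.
Proof.
move=> E Ei Em Eh Ec; apply: reach_step; rewrite /astep [atrans _ _]E.
by congr (Some (_, _)); apply: funext => -[[j|[b|phi]]|] /=.
Qed.

Lemma act_stay t : act_tape (go Stay) t = t.
Proof. by case: t. Qed.

Definition with_first (t : atape) (m : 'I_(nwork M).+1 -> atape) j :=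
  if j == ord0 then t else m j.

Lemma act_only a t m j :
  act_tape (only a j) (with_first t m j) = with_first (act_tape a t) m j.
Proof. by rewrite /only /with_first; case: eqP => // _; rewrite act_stay. Qed.

Lemma copy_phase w h c m :
  reach (size w).+1
    (conf Copy (word_tape w, 0%R) (with_first (word_tape [::], 0%R) m) h c)
    (conf Rewind (word_tape w, (size w)%:Z - 1)%R
       (with_first (word_tape w, (size w)%:Z - 1)%R m) h c).
Proof.
suff H v1 v2 : w = v1 ++ v2 ->
   reach (size v2).+1
    (conf Copy (word_tape w, (size v1)%:Z) (with_first (word_tape v1, (size v1)%:Z) m) h c)
    (conf Rewind (word_tape w, (size w)%:Z - 1)%R
       (with_first (word_tape w, (size w)%:Z - 1)%R m) h c).
  exact: (H [::] w).
elim: v2 v1 => [|x v2 IH] v1 wE /=.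
  apply: conf_step => [|||||].
  - by rewrite /= /aread /= nth_default // wE size_map cats0.
  - by [].
  - by move=> j; rewrite act_only.
  - by move=> ?; rewrite act_stay.
  - by move=> ?; rewrite act_stay.
  - by rewrite wE cats0; left.
apply: conf_step => [|||||].
- by rewrite /= /aread /= (nth_map false) ?wE ?size_cat /= ?nth_cat ?ltnn ?subnn //= -addSnnS leq_addr.
- by [].
- by move=> j; rewrite act_only /act_tape /= upd_word_tape.
- by move=> ?; rewrite act_stay.
- by move=> ?; rewrite act_stay.
- by have := IH (rcons v1 x); rewrite cat_rcons size_rcons PoszS; apply.
Qed.

(** [k] is the head position plus one: at [k = 0] the head is on the blank left of the word. *)
Lemma rewind_phase w h c m k : k <= size w ->
  reach k.+1
    (conf Rewind (word_tape w, k%:Z - 1)%R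
       (with_first (word_tape w, k%:Z - 1)%R m) h c)
    (conf (Sim (start M)) (word_tape w, 0%R)
       (with_first (word_tape w, 0%R) m) h c).
Proof.
elim: k => [|k IH] kw.
  apply: conf_step => [|||||].
  - by [].
  - by [].
  - by move=> j; rewrite act_only.
  - by move=> ?; rewrite act_stay.
  - by move=> ?; rewrite act_stay.
  - by left.
rewrite PoszS GRing.addrK; apply: conf_step => [|||||].
- by rewrite /= /aread /= (nth_map false).
- by [].
- by move=> j; rewrite act_only.
- by move=> ?; rewrite act_stay.
- by move=> ?; rewrite act_stay.
- by apply: IH; apply: ltnW.
Qed.

(** The extra step is the one that finds [M] halted and enters [Extract]. *)
Lemma sim_phase n (c0 f : config M) i m h c :
  run n c0 = Some f -> (forall j, rep (ctapes c0 j) (m j)) ->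
  exists2 m', reach n.+1 (conf (Sim (cstate c0)) i m h c)
                         (conf (Extract ord0) i m' h c)
    & forall j, rep (ctapes f j) (m' j).
Proof.
have E (c1 : config M) m1 : (forall j, rep (ctapes c1 j) (m1 j)) ->
   [ffun j => aread (assemble i m1 h c (Some (inl j)))]
   = [ffun j => tape_read (ctapes c1 j)].
  by move=> r; apply/ffunP=> j; rewrite !ffunE (rep_read (r j)).
elim: n c0 m => [|n IH] c0 m /=; case St: (step c0) => [c1|] // H r.
- case: H => <-; exists m => //.
  apply: conf_step => [|||||].
  - by rewrite /= (E _ _ r); move: St; rewrite /step; case: delta => // -[].
  - by rewrite act_stay.
  - by move=> ?; rewrite act_stay.
  - by move=> ?; rewrite act_stay.
  - by move=> ?; rewrite act_stay.
  - by left.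
- move: St; rewrite /step; case D: delta => [[q a]|] // [c1E].
  pose m1 j := act_tape (Some (a j).1, (a j).2) (m j).
  have [|m' rm' mf] := IH c1 m1 H.
    by move=> j; rewrite -c1E /= ffunE; apply: (rep_act (Some (a j).1, (a j).2)).
  exists m' => //; move: rm'; rewrite -c1E /=; apply: conf_step => [||||].
  - by rewrite /= (E _ _ r) D.
  - by rewrite act_stay.
  - by [].
  - by move=> ?; rewrite act_stay.
  - by move=> ?; rewrite act_stay.
- case: H => <-; exists m => //.
  apply: conf_step => [|||||].
  - by rewrite /= (E _ _ r); move: St; rewrite /step; case: delta => // -[].
  - by rewrite act_stay.
  - by move=> ?; rewrite act_stay.
  - by move=> ?; rewrite act_stay.
  - by move=> ?; rewrite act_stay.
  - by left.
Qed.

(** A cell holds only a bit or a blank, so a value in [B] is spread over one tape per [b]. Each such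
    tape is nonblank exactly at the positions below [size hs], hence a blank on the tape of [b0]
    signals the end. *)
Definition onehot (hs : seq B) (p : int) (b : B) : atape :=
  (word_tape [seq x == b | x <- hs], p).

Lemma extract_phase hs f p i m c :
  word_at f p (flatten [seq enc_elt b | b <- hs]) ->
  f (p + (size (flatten [seq enc_elt b | b <- hs]))%:Z)%R = None ->
  exists m',
  reach (size (flatten [seq enc_elt b | b <- hs])).+1
    (conf (Extract ord0) i (with_first (f, p) m) (onehot [::] 0%R) c)
    (conf (RewindH None) i m' (onehot hs ((size hs)%:Z - 1)%R) c).
Proof.
(* [v1] is already stored on the tapes of [h], and [v2] is still to be read. *)
suff H v1 v2 p1 : hs = v1 ++ v2 ->
   word_at f p1 (flatten [seq enc_elt b | b <- v2]) ->
   f (p1 + (size (flatten [seq enc_elt b | b <- v2]))%:Z)%R = None ->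
   reach (size (flatten [seq enc_elt b | b <- v2])).+1
    (conf (Extract ord0) i (with_first (f, p1) m) (onehot v1 (size v1)%:Z) c)
    (conf (RewindH None) i
      (with_first (f, p1 + (size (flatten [seq enc_elt b | b <- v2]))%:Z)%R m)
       (onehot hs ((size hs)%:Z - 1)%R) c).
  by move=> wf fe; eexists; apply: (H [::] hs).
elim: v2 v1 p1 => [|b v2 IH] v1 p1 hsE.
  rewrite /= GRing.addr0 => _ fp; apply: conf_step => [|||||].
  - by rewrite /= /aread /= fp.
  - by rewrite act_stay.
  - by move=> ?; rewrite act_stay.
  - by move=> ?.
  - by move=> ?; rewrite act_stay.
  - by rewrite hsE cats0; left.
rewrite /= {1}/enc_elt /enc_nat cat_rcons => /word_at_cat [wr].
rewrite size_nseq => -[fz wv]; rewrite size_cat size_nseq /= -addnS => fe.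
set r := nat_of_ord (enum_rank b) in wr fz wv *.
have r_lt : r < #|B| by apply: ltn_ord.
apply: (@reach_trans _ _ _ _ (conf (Extract (inord r)) i
  (with_first (f, p1 + r%:Z)%R m) (onehot v1 (size v1)%:Z) c)).
  (* Here [d] bits [true] of the current code remain to be read. *)
  have G d : d <= r -> reach d (conf (Extract (inord (r - d))) i
     (with_first (f, p1 + (r - d)%:Z)%R m) (onehot v1 (size v1)%:Z) c)
     (conf (Extract (inord r)) i
       (with_first (f, p1 + r%:Z)%R m) (onehot v1 (size v1)%:Z) c).
    elim: d => [|d IHd] dr; first by rewrite subn0; left.
    apply: conf_step => [|||||].
    - rewrite /= /aread /with_first /= (word_at_nth wr) ?size_nseq ?nth_nseq; last lia.
      by rewrite (_ : r - d.+1 < r) //; lia.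
    - by rewrite act_stay.
    - by move=> j; rewrite act_only.
    - by move=> ?; rewrite act_stay.
    - by move=> ?; rewrite act_stay.
    - rewrite inordK; last exact: leq_trans (leq_subr _ _) (ltnW r_lt).
      rewrite /act_tape /= -subSn // subSS -GRing.addrA.
      rewrite (_ : ((r - d.+1)%:Z + 1 = (r - d)%:Z)%R); last lia.
      by apply: IHd; apply: ltnW.
  have := G r (leqnn _); rewrite subnn GRing.addr0.
  by rewrite (_ : inord 0 = ord0) //; apply: val_inj; rewrite /= inordK.
apply: conf_step => [|||||].
- by rewrite /= /aread /with_first /= fz.
- by rewrite act_stay.
- by move=> j; rewrite act_only.
- move=> b'; rewrite /act_tape /onehot /= inordK; last exact: ltnW.
  have -> : (enum_rank b' == r :> nat) = (b == b').
    by rewrite /r eq_sym; apply/eqP/eqP => [/val_inj/enum_rank_inj|->].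
  have := upd_word_tape [seq x == b' | x <- v1] (b == b').
  by rewrite size_map -(map_rcons (fun x => x == b')) => ->.
- by move=> ?; rewrite act_stay.
- have := IH (rcons v1 b) (p1 + r%:Z + 1)%R; rewrite cat_rcons size_rcons.
  rewrite PoszS => /(_ hsE wv).
  rewrite (_ : (p1 + r%:Z + 1 + (size (flatten [seq enc_elt b | b <- v2]))%:Z
              = p1 + (r + (size (flatten [seq enc_elt b | b <- v2])).+1)%N%:Z)%R); last lia.
  by move=> /(_ fe).
Qed.

End Run.

(** * Reading the input and counting satisfied tuples for all patches *)

Section Eval.

Variables (s : signature) (B : fin_structure s) (M : TM) (L : nat) (b0 : B).

Local Notation patch := {ffun 'I_L -> option B}.
Local Notation N := (machine M L b0).
Local Notation reach := (@reach N).
Local Notation scanned := (scanned B L).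
Local Notation conf := (@conf s B M L b0).

Lemma cap0 : @ord0 L = cap L 0.
Proof. by apply: val_inj; rewrite /= capE min0n. Qed.

Lemma onehot_read hs k b : k < size hs ->
  aread (onehot hs k%:Z b) = Some (nth b0 hs k == b).
Proof. by move=> kh; rewrite /aread /= -map_comp (nth_map b0). Qed.

Lemma onehot_here hs k : k < size hs ->
  odflt b0 [pick b | aread (onehot hs k%:Z b) == Some true] = nth b0 hs k.
Proof.
move=> kh; case: pickP => [b|/(_ (nth b0 hs k))]; rewrite onehot_read //.
  by move/eqP => -[/eqP].
by rewrite eqxx.
Qed.

Lemma rewindH_phase hs k r i m c : k <= size hs ->
  reach k.+1
    (conf (RewindH r) i m (onehot hs (k%:Z - 1)%R) c)
    (conf (if r is Some (mm, j, t) then Next mm j t else Head ord0) i m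
       (onehot hs 0%R) c).
Proof.
elim: k => [|k IH] kw.
  apply: conf_step => [|||||].
  - by [].
  - by rewrite act_stay.
  - by move=> ?; rewrite act_stay.
  - by move=> b; rewrite /act_tape /=.
  - by move=> ?; rewrite act_stay.
  - by left.
rewrite PoszS GRing.addrK; apply: conf_step => [|||||].
- by rewrite [LHS]/= onehot_read.
- by rewrite act_stay.
- by move=> ?; rewrite act_stay.
- by move=> b; rewrite /act_tape /=.
- by move=> ?; rewrite act_stay.
- by apply: IH; apply: ltnW.
Qed.

Lemma head_phase n f p m h c : word_at f p (enc_nat n) ->
  reach n.+1 (conf (Head ord0) (f, p) m h c)
    (conf (Rel (cap L n) (insub 0)) (f, p + n.+1%:Z)%R m h c).
Proof.
rewrite /enc_nat -cats1 => /word_at_cat [wn]; rewrite size_nseq => -[fz _].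
have G d : d <= n -> reach d (conf (Head (cap L (n - d))) (f, p + (n - d)%:Z)%R m h c)
    (conf (Head (cap L n)) (f, p + n%:Z)%R m h c).
  elim: d => [|d IH] dn; first by rewrite subn0; left.
  apply: conf_step => [|||||].
  - rewrite /= /aread /= (word_at_nth wn) ?size_nseq ?nth_nseq; last lia.
    by rewrite (_ : n - d.+1 < n) //; lia.
  - by [].
  - by move=> ?; rewrite act_stay.
  - by move=> ?; rewrite act_stay.
  - by move=> ?; rewrite act_stay.
  - rewrite capS /act_tape /= -subSn // subSS -GRing.addrA.
    rewrite (_ : ((n - d.+1)%:Z + 1 = (n - d)%:Z)%R); last lia.
    by apply: IH; apply: ltnW.
have := G n (leqnn _); rewrite subnn GRing.addr0 -cap0 -[n.+1]addn1 => /reach_trans.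
apply; apply: conf_step => [|||||].
- by rewrite /= /aread /= fz.
- by [].
- by move=> ?; rewrite act_stay.
- by move=> ?; rewrite act_stay.
- by move=> ?; rewrite act_stay.
- by rewrite /act_tape /= addn1 PoszS GRing.addrA; left.
Qed.

(** While the unary rank is read, the heads on the tapes of [h] advance in step, so they end on the
    value of the element of rank [k]. Reading and rewinding take [k.+1] steps each. *)
Lemma elt_phase hs k f p mm i (t : scanned) m c :
  word_at f p (enc_nat k) -> k < size hs -> size t < max_arity s ->
  exists2 t' : scanned, t' = rcons t (nth b0 hs k, cap L k) :> seq _ &
  reach (k.+1 + k.+1)
    (conf (Elt mm i t ord0) (f, p) m (onehot hs 0%R) c)
    (conf (Next mm i t') (f, p + k.+1%:Z)%R m (onehot hs 0%R) c).
Proof.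
rewrite /enc_nat -cats1 => /word_at_cat [wn]; rewrite size_nseq => -[fz _] kh ta.
exists (insub_bseq _ (rcons t (nth b0 hs k, cap L k))).
  by rewrite /insub_bseq val_insubd size_rcons ta.
have G d : d <= k ->
    reach d (conf (Elt mm i t (cap L (k - d))) (f, p + (k - d)%:Z)%R m
               (onehot hs (k - d)%:Z) c)
            (conf (Elt mm i t (cap L k)) (f, p + k%:Z)%R m (onehot hs k%:Z) c).
  elim: d => [|d IH] dn; first by rewrite subn0; left.
  apply: conf_step => [|||||].
  - rewrite /= /aread /= (word_at_nth wn) ?size_nseq ?nth_nseq; last lia.
    by rewrite (_ : k - d.+1 < k) //; lia.
  - by [].
  - by move=> ?; rewrite act_stay.
  - by move=> b; rewrite /act_tape.
  - by move=> ?; rewrite act_stay.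
  - rewrite capS /act_tape /= -subSn // subSS -GRing.addrA.
    rewrite (_ : ((k - d.+1)%:Z + 1 = (k - d)%:Z)%R); last lia.
    by apply: IH; apply: ltnW.
have := G k (leqnn _); rewrite subnn GRing.addr0 -cap0 addSnnS => /reach_trans.
apply; apply: conf_step => [|||||].
- by rewrite [LHS]/= onehot_here // /aread [(f, _).1 _]/= fz.
- by [].
- by move=> ?; rewrite act_stay.
- by move=> b; rewrite /act_tape.
- by move=> ?; rewrite act_stay.
- rewrite /act_tape /= PoszS GRing.addrA.
  by apply: (@rewindH_phase _ k (Some _)); apply: ltnW.
Qed.

Lemma size_enc_nat k : size (enc_nat k) = k.+1.
Proof. by rewrite size_rcons size_nseq. Qed.

(** The head rests on the first blank after the marks, so that an increment is a single write and
    move. *)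
Definition counters (k : patch -> nat) (phi : patch) : atape :=
  (word_tape (nseq (k phi) true), (k phi)%:Z).

(** An element costs one step to enter [Elt] and at most [(size hs).*2] steps in [elt_phase], its
    rank being below [size hs]. The final step updates all counters at once. *)
Lemma tuple_phase hs ks f p mm i (t : scanned) m k :
  size t + size ks = arity i ->
  word_at f p (flatten [seq enc_nat x | x <- ks]) ->
  all (fun x => x < size hs) ks ->
  reach (size ks * (size hs).*2.+1).+1
    (conf (Next mm i t) (f, p) m (onehot hs 0%R) (counters k))
    (conf (Rel mm (Some i))
       (f, p + (size (flatten [seq enc_nat x | x <- ks]))%:Z)%R m
       (onehot hs 0%R)
       (counters (fun phi => k phi +
          counted i (t ++ [seq (nth b0 hs x, cap L x) | x <- ks]) phi))).
Proof.
elim: ks t p => [|x ks IH] t p sz /=.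
  move=> _ _; rewrite GRing.addr0 cats0; apply: conf_step => [|||||].
  - by rewrite /= -sz addn0 eqxx.
  - by rewrite act_stay.
  - by move=> ?; rewrite act_stay.
  - by move=> ?; rewrite act_stay.
  - by move=> phi /=; reflexivity.
  - rewrite (_ : (fun phi => _) = counters (fun phi => k phi + counted i t phi)); first by left.
    apply: funext => phi; rewrite /counters /act_tape.
    case: counted => /=; last by rewrite addn0.
    have := upd_word_tape (nseq (k phi) true) true; rewrite size_nseq => ->.
    by rewrite -cats1 nseqD addn1 PoszS.
rewrite size_cat /= => /word_at_cat [wx wks] /andP [xh ksh].
have ta : size t < max_arity s.
  rewrite /max_arity; apply: leq_trans (leq_bigmax i).
  by rewrite -sz /= -addSnnS leq_addr.
have [t' t'E r] := elt_phase mm i m (counters k) wx xh ta.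
rewrite mulSn -addnS addSn; apply: conf_step => [|||||].
- by rewrite /= ifF //; apply/eqP; move: sz => /=; lia.
- by rewrite act_stay.
- by move=> ?; rewrite act_stay.
- by move=> ?; rewrite act_stay.
- by move=> ?; rewrite act_stay.
apply: reach_trans (reach_leq _ r) _; first by rewrite -addnn leq_add.
have := IH t' (p + x.+1%:Z)%R; rewrite [size t']/= t'E cat_rcons PoszD GRing.addrA.
rewrite size_enc_nat; apply=> //; first by rewrite size_rcons addSnnS.
by rewrite size_enc_nat in wks.
Qed.

Variables (A : fin_structure s) (h : {ffun A -> B}).

Let n := #|A|.
Let hs := [seq h a | a <- enum A].

Lemma size_hs : size hs = n.
Proof. by rewrite size_map -cardE. Qed.

Lemma nth_hs a : nth b0 hs (enum_rank a) = h a.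
Proof.
by rewrite (nth_map a) -?cardE ?ltn_ord // nth_enum_rank.
Qed.

Definition patched (phi : patch) : {ffun A -> B} :=
  [ffun a => overwrite phi (h a) (enum_rank a)].

(** Truncating ranks is harmless by [overwrite_minn], so the data in the state decide whether the
    patched map satisfies the tuple. *)
Lemma counted_patched i (t : (arity i).-tuple A) phi :
  counted i [seq (nth b0 hs x, cap L x) | x <- [seq nat_of_ord (enum_rank a) | a <- t]] phi
  = (map_tuple (patched phi) t \in interp B i).
Proof.
have E : [seq overwrite phi x.1 x.2 | x : B * 'I_L.+1 <-
   [seq (nth b0 hs x, cap L x) | x <- [seq nat_of_ord (enum_rank a) | a <- t]]]
   = tval (map_tuple (patched phi) t).
  rewrite -!map_comp; apply: eq_map => a /=.
  by rewrite nth_hs capE overwrite_minn ffunE.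
rewrite /counted E; apply/exists_inP/idP => [[u ui /eqP ut]|ti].
  by rewrite -(val_inj ut : u = _).
by exists (map_tuple (patched phi) t).
Qed.

(** The bound of [tuple_phase], plus one step for the bit that precedes the tuple. *)
Let cost := (max_arity s * n.*2.+1).+2.

Lemma relation_phase i (ts : seq ((arity i).-tuple A)) f p mm m k :
  word_at f p (rcons (flatten [seq true :: flatten [seq enc_elt a | a <- tval t]
                              | t <- ts]) false) ->
  reach (size ts * cost).+1
    (conf (Rel mm (Some i)) (f, p) m (onehot hs 0%R) (counters k))
    (conf (Rel mm (insub i.+1))
       (f, p + (size (rcons (flatten [seq true :: flatten [seq enc_elt a | a <- tval t]
                              | t <- ts]) false))%:Z)%R m (onehot hs 0%R)
       (counters (fun phi => k phi +
          count (fun t => map_tuple (patched phi) t \in interp B i) ts))).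
Proof.
rewrite size_rcons; elim: ts p k => [|t ts IH] p k /=.
  move=> [fp _]; apply: conf_step => [|||||].
  - by rewrite /= /aread /= fp.
  - by [].
  - by move=> ?; rewrite act_stay.
  - by move=> ?; rewrite act_stay.
  - by move=> ?; rewrite act_stay.
  - rewrite (_ : (fun phi => _) = k); first by left.
    by apply: funext => phi; rewrite addn0.
rewrite rcons_cat => -[fp /word_at_cat [wt wts]].
rewrite mulSn -addnS {1}(erefl _ : cost = (max_arity s * n.*2.+1).+2) addSn; apply: conf_step => [|||||].
- by rewrite /= /aread /= fp.
- by [].
- by move=> ?; rewrite act_stay.
- by move=> ?; rewrite act_stay.
- by move=> ?; rewrite act_stay.
have E : flatten [seq enc_elt a | a <- tval t] =
  flatten [seq enc_nat x | x <- [seq nat_of_ord (enum_rank a) | a <- t]].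
  by rewrite -map_comp.
have T : reach (max_arity s * n.*2.+1).+1
    (conf (Next mm i [bseq]) (f, p + 1)%R m (onehot hs 0%R) (counters k))
    (conf (Rel mm (Some i))
       (f, p + 1 + (size (flatten [seq enc_elt a | a <- tval t]))%:Z)%R m
       (onehot hs 0%R)
       (counters (fun phi => k phi + (map_tuple (patched phi) t \in interp B i)))).
  rewrite E in wt *.
  apply: (@reach_leq _ (size [seq nat_of_ord (enum_rank a) | a <- t] * (size hs).*2.+1).+1).
    by rewrite ltnS size_hs size_map size_tuple leq_mul2r leq_bigmax orbT.
  have := @tuple_phase hs _ f (p + 1)%R mm i [bseq] m k _ wt _.
  rewrite size_map size_tuple => /(_ erefl) H.
  rewrite (_ : (fun phi => _) = fun phi => k phi +
    counted i [seq (nth b0 hs x, cap L x) |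
                 x <- [seq nat_of_ord (enum_rank a) | a <- t]] phi); last first.
    by apply: funext => phi; rewrite counted_patched.
  by apply: H; apply/allP => _ /mapP [a _ ->]; rewrite size_hs ltn_ord.
apply: reach_trans T _.
have := IH _ (fun phi => k phi + (map_tuple (patched phi) t \in interp B i)) wts.
rewrite size_cat -addnS -[in X in _ -> X](addSn (size _)) PoszD PoszS !GRing.addrA.
have pS x : (p + x.+1%:Z = p + 1 + x%:Z)%R by lia.
rewrite (pS (size _)).
rewrite (_ : (fun phi => _ + _ + _) = fun phi => k phi +
   ((map_tuple (patched phi) t \in interp B i) +
    count (fun t => map_tuple (patched phi) t \in interp B i) ts)) //.
by apply: funext => phi; rewrite addnA.
Qed.

(** [d] counts the relations still to be read; [insub j] becomes [None] when none is left, which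
    ends the scan. *)
Lemma relations_phase d j f p mm m k : nrel s - j = d ->
  word_at f p (flatten [seq enc_rel A i | i <- drop j (enum 'I_(nrel s))]) ->
  reach (\sum_(i <- drop j (enum 'I_(nrel s))) (#|interp A i| * cost).+1)
    (conf (Rel mm (insub j)) (f, p) m (onehot hs 0%R) (counters k))
    (conf (Rel mm None)
       (f, p + (size (flatten [seq enc_rel A i | i <- drop j (enum 'I_(nrel s))]))%:Z)%R
       m (onehot hs 0%R)
       (counters (fun phi => k phi + \sum_(i <- drop j (enum 'I_(nrel s)))
          #|[set t in interp A i | map_tuple (patched phi) t \in interp B i]|))).
Proof.
elim: d j p k => [|d IH] j p k.
  move=> jn _; rewrite drop_oversize ?size_enum_ord; last lia.
  rewrite insubN; last lia.
  rewrite big_nil /= GRing.addr0 (_ : (fun phi => _) = k); first by left.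
  by apply: funext => phi; rewrite big_nil addn0.
move=> jn; have jlt : j < nrel s by lia.
pose i := Ordinal jlt; have -> : drop j (enum 'I_(nrel s)) = i :: drop j.+1 (enum 'I_(nrel s)).
  rewrite (drop_nth i) ?size_enum_ord //; congr cons; apply: val_inj.
  by rewrite /= nth_enum_ord.
rewrite insubT -/i /= big_cons size_cat => /word_at_cat [wi wis].
have C phi : count (fun t => map_tuple (patched phi) t \in interp B i) (enum (interp A i)) =
   #|[set t in interp A i | map_tuple (patched phi) t \in interp B i]|.
  rewrite cardE -size_filter /enum_mem -filter_predI; congr size; apply: eq_filter => t /=.
  by rewrite inE andbC.
have := relation_phase mm m k wi; rewrite -cardE => /reach_trans; apply.
have := IH j.+1 _ (fun phi => k phi + count (fun t => map_tuple (patched phi) t \in interp B i)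
                                        (enum (interp A i))) _ wis.
rewrite PoszD GRing.addrA (_ : (fun phi => k phi + _ + _) =
    fun phi => k phi + \sum_(i <- i :: drop j.+1 (enum 'I_(nrel s)))
      #|[set t in interp A i | map_tuple (patched phi) t \in interp B i]|).
  by apply; lia.
by apply: funext => phi; rewrite big_cons addnA C.
Qed.

End Eval.

(** * Selecting the best patch and writing the output *)

Section Finish.

Variables (s : signature) (B : fin_structure s) (M : TM) (L : nat) (b0 : B).

Local Notation patch := {ffun 'I_L -> option B}.
Local Notation N := (machine M L b0).
Local Notation reach := (@reach N).
Local Notation conf := (@conf s B M L b0).

Lemma counter_read k d (phi : patch) : 0 < d ->
  (aread (word_tape (nseq (k phi) true), ((k phi)%:Z - d%:Z)%R) == Some true) =
  (d <= k phi).
Proof.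
move=> d0; rewrite /aread [(_, _).1]/= [(_, _).2]/=.
case: leqP => h.
  rewrite subzn // word_tape_nth ?size_nseq ?nth_nseq; last lia.
  by rewrite ifT //; lia.
by rewrite word_tape_out // ; apply/orP; left; lia.
Qed.

(** All counter heads move left together from the ends of their marks. After [d > 0] moves, a head
    scans [true] exactly when its count is at least [d]. The machine switches to such a covering
    patch as long as there is one, so its last candidate is the best. *)
Lemma compare_phase (k : patch -> nat) (m : 'I_L.+1) T f p mt h :
  (exists phi : patch, covers m phi) -> (forall phi, k phi <= T) ->
  exists phi c', [/\ covers m phi, forall psi, covers m psi -> k psi <= k phi
    & reach T.+3 (conf (Rel m None) (f, p) mt h (counters k))
                 (conf (Out phi ord0) (f, p + 1)%R mt h c')].
Proof.
move=> [phi0 cov0] kT.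
(* The candidate [phi] has value at least [d], and the heads now test for value at least [d.+1]. *)
have G d phi e : T.+1 - d = e -> covers m phi -> d <= k phi ->
  exists psi c', [/\ covers m psi, forall psi', covers m psi' -> k psi' <= k psi
    & reach e.+1 (conf (Cmp m phi) (f, p) mt h
              (fun psi => (word_tape (nseq (k psi) true), (k psi)%:Z - d.+1%:Z)%R))
                 (conf (Out psi ord0) (f, p + 1)%R mt h c')].
  (* At [e = 0] the value of the candidate would exceed [T]. *)
  elim: e d phi => [|e IH] d phi de cov dk; first by have := kT phi; lia.
  case P : [pick psi | covers m psi && (d < k psi)] => [psi|].
    have /andP [cov' dk'] : covers m psi && (d < k psi).
      by move: P; case: pickP => // x cx [<-].
    have [|psi' [c' [cov'' mx r]]] := IH d.+1 psi _ cov' dk'; first lia.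
    exists psi', c'; split => //; apply: conf_step r.
    - rewrite /=; under eq_pick => x do rewrite counter_read //.
      by rewrite P.
    - by rewrite act_stay.
    - by move=> ?; rewrite act_stay.
    - by move=> ?; rewrite act_stay.
    - by move=> x; rewrite /act_tape /=; congr pair; lia.
  eexists phi, _; split=> //.
    move=> psi cov'; move: P; case: pickP => // /(_ psi); rewrite cov' /= => h' _; lia.
  apply: conf_step => [|||||].
  - rewrite /=; under eq_pick => x do rewrite counter_read //.
    by rewrite P.
  - by [].
  - by move=> ?; rewrite act_stay.
  - by move=> ?; rewrite act_stay.
  - by move=> ?; rewrite act_stay.
  - by left.
pose phi1 := odflt [ffun=> None] [pick phi : patch | covers m phi].
have cov1 : covers m phi1.
  by rewrite /phi1; case: pickP => [//|/(_ phi0)]; rewrite cov0.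
have [psi [c' [cov' mx r]]] := G 0 phi1 T.+1 (subn0 _) cov1 isT.
exists psi, c'; split => //; apply: conf_step r.
- by [].
- by rewrite act_stay.
- by move=> ?; rewrite act_stay.
- by move=> ?; rewrite act_stay.
- by move=> x; rewrite /act_tape /=; congr pair; lia.
Qed.

(* The output [v] is written after the input [w], from which it is separated
   by one blank. *)
Definition io_tape (w v : seq bool) (i : int) : symbol :=
  if (i <= (size w)%:Z)%R then word_tape w i
  else word_tape v (i - (size w).+1%:Z)%R.

Lemma io_tape_nil w : io_tape w [::] = word_tape w.
Proof.
apply: funext => i; rewrite /io_tape; case: ifPn => // h.
rewrite [RHS]word_tape_out; last lia.
by case: (i - _)%R => // k; rewrite /= nth_nil.
Qed.

Lemma io_tape_upd w v b :
  upd (io_tape w v) ((size w).+1 + size v)%:Z (Some b) = io_tape w (rcons v b).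
Proof.
apply: funext => i; rewrite /io_tape -upd_word_tape /upd.
case: eqP => [->|h].
  by rewrite ifF ?ifT //; lia.
by case: ifP => // h'; rewrite ifF //; lia.
Qed.

Lemma put_phase w v phi c k m hs p ct : k <= #|B| ->
  reach k.+1
    (conf (Put phi c (inord k)) (io_tape w v, ((size w).+1 + size v)%:Z) m
       (onehot hs p) ct)
    (conf (Out phi (cap L c.+1))
       (io_tape w (v ++ enc_nat k), ((size w).+1 + size (v ++ enc_nat k))%:Z) m
       (onehot hs (p + 1)%R) ct).
Proof.
elim: k v => [|k IH] v kB.
  apply: conf_step => [|||||].
  - by rewrite /= inordK.
  - by rewrite /act_tape /= io_tape_upd; reflexivity.
  - by move=> ?; rewrite act_stay.
  - by move=> b; rewrite /act_tape /=.
  - by move=> ?; rewrite act_stay.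
  - rewrite cats1 size_rcons addnS PoszS; left.
apply: conf_step => [|||||].
- by rewrite /= inordK.
- by rewrite /act_tape /= io_tape_upd; reflexivity.
- by move=> ?; rewrite act_stay.
- by move=> b; rewrite act_stay.
- by move=> ?; rewrite act_stay.
- have := IH (rcons v true) (ltnW kB).
  by rewrite cat_rcons size_rcons addnS PoszS; apply.
Qed.

(** At [k = 0] the head is on the blank between input and output; one step right brings it to where
    [output] starts reading. *)
Lemma back_phase w v k m h c : k <= size v ->
  reach k.+1 (conf Back (io_tape w v, (size w + k)%:Z) m h c)
             (conf Halt (io_tape w v, (size w).+1%:Z) m h c).
Proof.
elim: k => [|k IH] kv.
  rewrite addn0; apply: conf_step => [|||||].
  - by rewrite /= areadE /io_tape ifT ?word_tape_out //; lia.
  - by [].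
  - by move=> ?; rewrite act_stay.
  - by move=> ?; rewrite act_stay.
  - by move=> ?; rewrite act_stay.
  - by rewrite PoszS; left.
apply: conf_step => [|||||].
- rewrite /= areadE /io_tape ifF; last lia.
  rewrite (_ : (_ - _)%R = k%:Z); last lia.
  by rewrite word_tape_nth.
- by [].
- by move=> ?; rewrite act_stay.
- by move=> ?; rewrite act_stay.
- by move=> ?; rewrite act_stay.
- rewrite addnS PoszS /act_tape /= GRing.addrK.
  by apply: IH; apply: ltnW.
Qed.

(** An element takes one step to look up its value and at most [#|B|] steps to write the code. *)
Lemma output_phase w v phi hs a d m ct : size hs - a = d -> a <= size hs ->
  reach (d * #|B|.+1).+1
    (conf (Out phi (cap L a)) (io_tape w v, ((size w).+1 + size v)%:Z) m
       (onehot hs a%:Z) ct)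
    (let v' := v ++ flatten [seq enc_elt (overwrite phi (nth b0 hs k) k)
                            | k <- iota a d] in
     conf Back (io_tape w v', (size w + size v')%:Z) m
       (onehot hs (size hs)%:Z) ct).
Proof.
elim: d a v => [|d IH] a v ad ah /=.
  have -> : a = size hs by lia.
  rewrite cats0; apply: conf_step => [|||||].
  - rewrite /= /aread /= nth_default ?size_map //.
  - by rewrite /act_tape /= addSn PoszS GRing.addrK.
  - by move=> ?; rewrite act_stay.
  - by move=> b; rewrite act_stay.
  - by move=> ?; rewrite act_stay.
  - by left.
have ah' : a < size hs by lia.
rewrite mulSn addSn -addnS; apply: conf_step => [|||||].
- by rewrite [LHS]/= onehot_here // (onehot_read b0).
- by rewrite act_stay.
- by move=> ?; rewrite act_stay.
- by move=> b; rewrite act_stay.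
- by move=> ?; rewrite act_stay.
rewrite capE overwrite_minn; set b := overwrite phi _ _.
have r_lt := ltn_ord (enum_rank b).
have /reach_leq := put_phase w v phi (cap L a) m hs a%:Z ct (ltnW r_lt).
move=> /(_ _ r_lt) /reach_trans; apply.
rewrite capS catA -PoszS.
by apply: (IH a.+1 (v ++ enc_elt b)); lia.
Qed.

End Finish.

(** * Correctness of the whole run *)

Section Correctness.

Variables (s : signature) (B : fin_structure s) (M : TM) (L : nat) (b0 : B).
Variables (A : fin_structure s) (h : {ffun A -> B}).

Local Notation patch := {ffun 'I_L -> option B}.
Local Notation N := (machine M L b0).

Lemma io_tape_word w v : word_at (io_tape w v) (size w).+1%:Z v /\
  io_tape w v ((size w).+1%:Z + (size v)%:Z)%R = None.
Proof.
split; last by rewrite /io_tape ifF; [rewrite word_tape_out //; lia | lia].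
apply: word_at_offset (word_tape_at v) => k kv.
by rewrite /io_tape ifF; [congr word_tape; lia | lia].
Qed.

(** The summands bound the phases in order: copy, rewind, simulation, extraction, rewinding of [h],
    header, relations, comparison, output, return. *)
Definition steps (T : nat) : nat :=
  let n := #|A| in
  let w := enc_struct A in
  let r := \sum_(i < nrel s) #|interp A i| in
  (size w).+1 + ((size w).+1 + (T.+1 + ((n * #|B|).+1 + (n.+1 + (n.+1 +
  (\sum_(i < nrel s) (#|interp A i| * (max_arity s * n.*2.+1).+2).+1 +
   (r.+3 + ((n * #|B|.+1).+1 + (n * #|B|).+1)))))))).

Lemma size_enc_map (g : {ffun A -> B}) : size (enc_map g) <= #|A| * #|B|.
Proof.
rewrite /enc_map size_flatten /shape -map_comp cardE.
elim: (enum A) => //= a l IH; rewrite mulSn leq_add //.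
by rewrite /enc_elt size_enc_nat ltn_ord.
Qed.

Lemma csp_value_leq (g : {ffun A -> B}) :
  csp_value g <= \sum_(i < nrel s) #|interp A i|.
Proof.
by apply: leq_sum => i _; apply: subset_leq_card; apply/subsetP => t; rewrite inE => /andP [].
Qed.

(** The phases are chained. Nothing is assumed on the quality of [h], which separates the machine
    from the ratio; the last hypothesis gives the comparison a first candidate. *)
Theorem machine_correct T (f : config M) :
  run T (init_config M (enc_struct A)) = Some f -> output f = enc_map h ->
  (exists phi : patch, covers #|A| phi) ->
  exists (phi : patch) (F : config (TM_of_amachine N)),
    [/\ covers #|A| phi,
        forall psi : patch, covers #|A| psi ->
          csp_value (patched h psi) <= csp_value (patched h phi),
        run (steps T) (init_config (TM_of_amachine N) (enc_struct A)) = Some F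
      & output F = enc_map (patched h phi)].
Proof.
move=> Mrun Mout [phi0 cov0].
set n := #|A|; set w := enc_struct A.
pose hs := [seq h a | a <- enum A].
have szhs : size hs = n by rewrite size_hs.
have encE : enc_map h = flatten [seq enc_elt b | b <- hs] by rewrite /hs -map_comp.
have blk : blank_tape = (word_tape [::], 0%R).
  by congr pair; apply: funext => -[k|k] //=; rewrite nth_nil.
have wE : w = enc_nat n ++ flatten [seq enc_rel A i | i <- drop 0 (enum 'I_(nrel s))].
  by rewrite drop0.
have /word_at_cat [wn wr] : word_at (word_tape w) 0 (enc_nat n ++ flatten [seq enc_rel A i | i <- drop 0 (enum 'I_(nrel s))]).
  by rewrite -wE; apply: word_tape_at.
pose k0 : patch -> nat := fun=> 0.
pose m0 : 'I_(nwork M).+1 -> atape := fun=> blank_tape.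
have init_rep j : rep (ctapes (init_config M w) j) (with_first (word_tape w, 0%R) m0 j).
  rewrite /= ffunE /with_first; case: ifP => _; [exact: rep_word | exact: rep_blank].
have [m' simr mr] := sim_phase b0 (word_tape w, 0%R) (onehot [::] 0%R) (counters k0) Mrun init_rep.
(* The word on tape [ord0] of [M] is the code of [h] that [extract_phase] expects. *)
have [uw ue] := output_word (mr ord0).
rewrite -/(output f) Mout encE in uw ue.
have mE : m' = with_first ((m' ord0).1, (m' ord0).2) m'.
  by apply: funext => j; rewrite /with_first; case: eqP => // ->; case: (m' ord0).
have [m'' extr] := extract_phase b0 (word_tape w, 0%R) m' (counters k0) uw ue.
have rew := rewindH_phase b0 None (word_tape w, 0%R) m'' (counters k0) (leqnn (size hs)).
have hdr := head_phase b0 m'' (onehot hs 0%R) (counters k0) wn.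
rewrite size_enc_nat in wr.
have rel := relations_phase (M := M) b0 h (cap L n) m'' k0 (erefl (nrel s - 0)) wr.
have cov1 : exists phi : patch, covers (cap L n) phi.
  by exists phi0; rewrite capE covers_minn.
have posE : (n.+1%:Z + (size (flatten [seq enc_rel A i | i <- drop 0 (enum 'I_(nrel s))]))%:Z = (size w)%:Z)%R.
  by rewrite wE size_cat size_enc_nat PoszD.
have csE : (fun phi : patch => k0 phi + \sum_(i <- drop 0 (enum 'I_(nrel s)))
        #|[set t in interp A i | map_tuple (patched h phi) t \in interp B i]|) =
    (fun phi => csp_value (patched h phi)).
  by apply: funext => phi; rewrite add0n drop0 big_enum.
rewrite GRing.add0r posE csE in rel.
have [phi [c' [cov mx cmp]]] := @compare_phase s B M L b0 _ _ _ (word_tape w)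
  (size w)%:Z m'' (onehot hs 0%R) cov1
  (fun phi : patch => csp_value_leq (patched h phi)).
have out := output_phase b0 w [::] phi m'' c' (subn0 (size hs)) (leq0n _).
set v := enc_map (patched h phi).
(* Entry by entry, the word written is the code of the patched map: the element of rank [k] has its
   value at position [k] of [hs]. *)
have vE : [::] ++ flatten [seq enc_elt (overwrite phi (nth b0 hs k) k) | k <- iota 0 (size hs)] = v.
  rewrite /v /enc_map; congr flatten.
  apply: (@eq_from_nth _ [::]); first by rewrite !size_map size_iota.
  move=> k; rewrite size_map size_iota => kh.
  have kA : k < #|A| by rewrite -/n -szhs.
  pose a := enum_val (Ordinal kA).
  have ra : enum_rank a = k :> nat by rewrite enum_valK.
  have ha : nth b0 hs k = h a by rewrite -(nth_hs b0 h a) ra.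
  have nk : nth a (enum A) k = a := esym (enum_val_nth a (Ordinal kA)).
  rewrite (nth_map 0) ?size_iota // nth_iota // add0n ha.
  by rewrite [RHS](nth_map a) -?cardE // nk ffunE ra.
rewrite vE io_tape_nil addn0 -cap0 in out.
have [fin1 fin2] := io_tape_word w v.
have bck := back_phase b0 w m'' (onehot hs (size hs)%:Z) c' (leqnn (size v)).
have cpy := copy_phase b0 w (onehot [::] 0%R) (counters k0) m0.
have rwd := rewind_phase b0 (onehot [::] 0%R) (counters k0) m0 (leqnn (size w)).
have blkE : init_aconf N w = @conf s B M L b0 Copy (word_tape w, 0%R) (with_first (word_tape [::], 0%R) m0) (onehot [::] 0%R) (counters k0).
  congr pair; apply: funext => -[[j|[b|psi]]|] //=; rewrite blk //.
  by rewrite /with_first /m0 blk; case: eqP.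
have R : reach (steps T) (init_aconf N w) (@conf s B M L b0 Halt (io_tape w v, (size w).+1%:Z) m'' (onehot hs (size hs)%:Z) c').
  rewrite blkE /steps; apply: reach_trans cpy _; apply: reach_trans rwd _.
  apply: reach_trans simr _; rewrite mE.
  apply: reach_trans (reach_leq _ extr) _; first by rewrite -encE ltnS size_enc_map.
  apply: reach_trans (reach_leq _ rew) _; first by rewrite szhs.
  apply: reach_trans hdr _.
  rewrite GRing.add0r; apply: reach_trans (reach_leq _ rel) _.
    by rewrite drop0 big_enum.
  apply: reach_trans cmp _.
  rewrite -PoszS; apply: reach_trans (reach_leq _ out) _; first by rewrite szhs.
  by apply: reach_leq bck; rewrite ltnS size_enc_map.
have [F runF outF] := TM_of_amachine_run R (erefl _) fin1 fin2.
exists phi, F; split=> //; first by rewrite -covers_minn -capE.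
by move=> psi; rewrite -covers_minn -capE; apply: mx.
Qed.

End Correctness.

(** * Loss of value by patching *)

Section Blocks.

Variables (s : signature) (A B : fin_structure s) (b0 : B) (h : {ffun A -> B}).

Lemma patched_surjective L (phi : {ffun 'I_L -> option B}) :
  covers #|A| phi -> [forall b, exists a, patched h phi a == b].
Proof.
move=> /forallP cov; apply/forallP => b.
have /existsP [i /andP [iA /eqP phiE]] := cov b.
apply/existsP; exists (enum_val (Ordinal iA)).
by rewrite ffunE enum_valK /= /overwrite valK phiE.
Qed.

(** When all ranks are below [L], a patch can prescribe every value of [g]; the default [b0] fills
    the positions that are not ranks in [A]. *)
Lemma patched_all L (g : {ffun A -> B}) :
  #|A| <= L -> [forall b, exists a, g a == b] ->
  exists2 phi : {ffun 'I_L -> option B}, covers #|A| phi & patched h phi = g.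
Proof.
move=> AL /forallP sur; pose gs := [seq g a | a <- enum A].
exists [ffun i : 'I_L => Some (nth b0 gs i)].
  apply/forallP => b; have /existsP [a /eqP ga] := sur b.
  apply/existsP; exists (Ordinal (leq_trans (ltn_ord (enum_rank a)) AL)).
  by rewrite ffunE /= ltn_ord nth_hs ga eqxx.
apply/ffunP => a; rewrite ffunE /overwrite.
by rewrite insubT ?(leq_trans (ltn_ord _) AL) // => lt; rewrite ffunE /= nth_hs.
Qed.

Variable N : nat.

(** The ranks from [j * #|B|] to [j.+1 * #|B|], the latter excluded, are sent bijectively onto [B],
    and the others are left to [h]. Distinct blocks are disjoint. *)
Definition block (j : nat) : {ffun 'I_(N * #|B|) -> option B} :=
  [ffun i : 'I_(N * #|B|) => if i %/ #|B| == j then Some (nth b0 (enum B) (i %% #|B|)) else None].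

Lemma block_covers j n : j < N -> j.+1 * #|B| <= n -> covers n (block j).
Proof.
move=> jN jn; have B0 : 0 < #|B| by apply/card_gt0P; exists b0.
apply/forallP => b; have r_lt := ltn_ord (enum_rank b).
have lt m : j < m -> j * #|B| + enum_rank b < m * #|B|.
  move=> jm; apply: leq_trans (_ : j.+1 * #|B| <= _); last by rewrite leq_mul2r jm orbT.
  by rewrite mulSn addnC ltn_add2r.
apply/existsP; exists (Ordinal (lt N jN)).
rewrite (leq_trans (lt j.+1 _) jn) //= ffunE /=.
by rewrite divnMDl // divn_small // addn0 eqxx modnMDl modn_small // nth_enum_rank.
Qed.

Lemma block_miss j a : enum_rank a %/ #|B| != j -> patched h (block j) a = h a.
Proof.
move=> aj; rewrite ffunE /overwrite; case: insubP => // i _ iE.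
by rewrite ffunE iE (negPf aj).
Qed.

Lemma card_ord_in (l : seq nat) : #|[set j : 'I_N | val j \in l]| <= size l.
Proof.
rewrite cardE -(size_map val); apply: uniq_leq_size.
  by rewrite (map_inj_uniq val_inj) enum_uniq.
by move=> x /mapP [j]; rewrite mem_enum inE => jl ->.
Qed.

(** A patch can change the image of [t] only if its block contains an entry of [t], and [t] has at
    most [max_arity s] entries. *)
Lemma block_hits i (t : (arity i).-tuple A) : map_tuple h t \in interp B i ->
  N <= #|[set j : 'I_N | map_tuple (patched h (block j)) t \in interp B i]|
       + max_arity s.
Proof.
move=> ht; set S := [set j | _].
rewrite -[X in X <= _]card_ord -(cardsC S) leq_add2l.
pose l := [seq enum_rank a %/ #|B| | a <- t].
apply: leq_trans (leq_bigmax i); rewrite -[X in _ <= X](size_tuple (map_tuple h t)).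
rewrite size_map -(size_map (fun a => enum_rank a %/ #|B|)) -/l.
apply: leq_trans (card_ord_in l); apply: subset_leq_card; apply/subsetP => j.
rewrite !inE; apply: contraR => jl.
rewrite (_ : map_tuple _ t = map_tuple h t) //; apply: val_inj => /=.
apply/eq_in_map => a at_; apply: block_miss; apply: contraNN jl => /eqP jE.
rewrite -[val j]/(nat_of_ord j) -jE; exact: (map_f (fun a => enum_rank a %/ #|B|)).
Qed.

(* Each tuple that [h] satisfies meets at most [max_arity s] of the [N]
   disjoint blocks, so some block costs at most a fraction [max_arity s / N]
   of the value. *)
Lemma block_average v :
  (forall j : 'I_N, csp_value (patched h (block j)) <= v) ->
  N * csp_value h <= N * v + max_arity s * csp_value h.
Proof.
move=> vmax.
apply: (@leq_trans (\sum_(j < N) csp_value (patched h (block j))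
                    + max_arity s * csp_value h)); last first.
  by rewrite leq_add2r -[N in N * v]card_ord -sum_nat_const; apply: leq_sum.
(* With the sum over blocks innermost, [block_hits] applies to each tuple satisfied by [h]. *)
rewrite exchange_big /= !big_distrr /= -big_split /=; apply: leq_sum => i _.
have cardE' (g : {ffun A -> B}) : #|[set t in interp A i | map_tuple g t \in interp B i]|
    = \sum_(t in interp A i) (map_tuple g t \in interp B i).
  by rewrite -sum1_card big_mkcond [RHS]big_mkcond; apply: eq_bigr => t _; rewrite inE; case: (t \in _); case: (_ \in _).
under [X in _ <= X + _]eq_bigr => j _ do rewrite cardE'.
rewrite cardE' exchange_big !big_distrr /= -big_split /=.
apply: leq_sum => t _; case: (boolP (map_tuple h t \in _)) => [ht|_]; last by rewrite !muln0.
rewrite !muln1; apply: leq_trans (block_hits ht) _; rewrite leq_add2r.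
rewrite -sum1_card big_mkcond; apply: leq_sum => j _; rewrite inE.
by case: (_ \in _).
Qed.

End Blocks.

(** * Polynomial running time *)

Lemma size_enc_rel (s : signature) (A : fin_structure s) i :
  size (enc_rel A i) <= (#|interp A i| * (max_arity s * #|A|).+1).+1.
Proof.
rewrite size_rcons ltnS size_flatten /shape -map_comp cardE.
elim: (enum (interp A i)) => //= t l IH; rewrite mulSn leq_add // ltnS.
apply: leq_trans (_ : arity i * #|A| <= _); last by rewrite leq_mul2r leq_bigmax orbT.
rewrite size_flatten /shape -map_comp -[X in X * _](size_tuple t).
elim: (tval t) => //= a l' IH'; rewrite mulSn leq_add //.
by rewrite /enc_elt size_enc_nat ltn_ord.
Qed.

Lemma size_enc_struct (s : signature) (A : fin_structure s) :
  size (enc_struct A) <= #|A|.+1 +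
    \sum_(i < nrel s) (#|interp A i| * (max_arity s * #|A|).+1).+1.
Proof.
rewrite size_cat size_enc_nat leq_add2l size_flatten /shape -map_comp.
rewrite -big_enum /=; elim: (enum _) => [|i l IH] /=; first by rewrite big_nil.
by rewrite big_cons leq_add // size_enc_rel.
Qed.

Definition overhead (s : signature) (B : fin_structure s) : nat :=
  20 + 8 * max_arity s + 3 * nrel s + 3 * #|B|.

Lemma steps_bound (s : signature) (A B : fin_structure s) T :
  steps B A T <= T + overhead B * struct_size A ^ 2 + overhead B.
Proof.
rewrite /overhead /steps /struct_size.
have := size_enc_struct A.
have sumS (m : nat) : \sum_(i < nrel s) (#|interp A i| * m).+1 =
    (\sum_(i < nrel s) #|interp A i|) * m + nrel s.
  under eq_bigr => i _ do rewrite -addn1.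
  by rewrite big_split /= -big_distrl /= sum1_card card_ord.
rewrite !sumS.
clear sumS; move: (size _) (\sum_(i < _) _) => w r; move: (max_arity s) (#|A|) (#|B|) => K n b.
move: (nrel s) => l hw.
(* The products that occur are bounded by multiples of the squared size, which then becomes a
   variable [q]. *)
have rn : r * n <= (n + r) ^ 2 by nia.
have nq : n + r <= (n + r) ^ 2 by nia.
have Krn : K * (r * n) <= K * (n + r) ^ 2 by rewrite leq_mul2l rn orbT.
have Kr : K * (n + r) <= K * (n + r) ^ 2 by rewrite leq_mul2l nq orbT.
have bn : b * (n + r) <= b * (n + r) ^ 2 by rewrite leq_mul2l nq orbT.
move: ((n + r) ^ 2) nq rn Krn Kr bn => q nq rn Krn Kr bn.
nia.
Qed.

Import Order.TTheory GRing.Theory Num.Theory.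

(** The exponent [d.+2] dominates both [d] and 2 up to an additive 1, which covers [q = 0] with
    exponent 0. Doubling the constants absorbs it. *)
Lemma polynomial_bound (c d a q : nat) :
  c * q ^ d + c + a * q ^ 2 + a <= (c.*2 + a.*2) * q ^ d.+2 + (c.*2 + a.*2).
Proof.
have leX k : k <= d.+2 -> q ^ k <= q ^ d.+2 + 1.
  case: q => [|q] kd; last by rewrite addn1 leqW // leq_pexp2l.
  by case: k kd => // k _; rewrite exp0n.
have Hd : c * q ^ d <= c * (q ^ d.+2 + 1) by rewrite leq_mul2l leX ?orbT // ltnW.
have H2 : a * q ^ 2 <= a * (q ^ d.+2 + 1) by rewrite leq_mul2l leX ?orbT.
move: (q ^ d) (q ^ 2) (q ^ d.+2) Hd H2 => x y z; nia.
Qed.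

Lemma run_leq (M : TM) m n (c f : config M) :
  m <= n -> run m c = Some f -> run n c = Some f.
Proof.
elim: m n c => [|m IH] [|n] c //= mn; case: (step c) => // c'.
exact: IH.
Qed.

(** * The approximation ratio *)

Local Open Scope ring_scope.

(** [o] and [os] stand for the optima without and with surjectivity, [vh] for the value of [h], [vg]
    for that of the best patch. If [r - e] is positive, then [(r - e) * os <= (r - e) * o <= vh - e
    * vh <= vg]: the second inequality uses [r * o <= vh <= o], the third [K < e * N] and the
    averaging bound. *)
Lemma approx_arith (R : realType) (r e : R) (N K vh vg o os : nat) :
  0 < e -> K%:R < e * N%:R -> (0 < os)%N -> (os <= o)%N -> (vh <= o)%N ->
  r * o%:R <= vh%:R -> (N * vh <= N * vg + K * vh)%N ->
  (r - e) * os%:R <= vg%:R.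
Proof.
move=> e0 KN os0 oso vho hr avg.
have N0 : 0 < N%:R :> R.
  by rewrite -(pmulr_rgt0 _ e0); apply: le_lt_trans KN.
have [re0|re0] := lerP (r - e) 0.
  by apply: le_trans (ler0n _ _); rewrite mulr_le0_ge0.
have osoR : os%:R <= o%:R :> R by rewrite ler_nat.
have vhoR : vh%:R <= o%:R :> R by rewrite ler_nat.
have avgR : N%:R * vh%:R <= N%:R * vg%:R + K%:R * vh%:R :> R.
  by rewrite -!natrM -natrD ler_nat.
apply: le_trans (_ : (r - e) * o%:R <= _); first by rewrite ler_pM2l.
apply: le_trans (_ : vh%:R - e * vh%:R <= _).
  by rewrite mulrBl lerB // ler_wpM2l // ltW.
rewrite -(ler_pM2l N0) mulrBr.
have : K%:R * vh%:R <= e * N%:R * vh%:R by rewrite ler_wpM2r // ltW.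
move: avgR; lra.
Qed.

Lemma csp_value_opt (s : signature) (B A : fin_structure s) (P : map_problem B)
  (g : {ffun A -> B}) : solution P g -> (csp_value g <= opt P A)%N.
Proof. by move=> Pg; apply: (leq_bigmax_cond (F := @csp_value s A B)). Qed.

Theorem theorem2 (R : realType) (s : signature) (B : fin_structure s) (r : R)
    (hr : 0 < r <= 1) :
  poly_time_approximable (max_csp B) r ->
  forall e : R, 0 < e -> poly_time_approximable (max_sur_csp B) (r - e).
Proof.
move=> [M [c [d alg]]] e e0.
(* A one-point structure without tuples is an instance of Max-CSP, and a map from it to [B] gives a
   point of [B]. *)
have [b0 _] : exists b : B, True.
  have [h _] := alg (@FinStructure s unit (fun=> set0)) I.
  by exists (h tt).
have [N N0 KN] : exists2 N : nat, (0 < N)%N & (max_arity s)%:R < e * N%:R.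
  (* The successor makes [N] positive, so that block 0 exists. *)
  exists (Num.bound ((max_arity s)%:R / e)).+1 => //.
  rewrite mulrC -ltr_pdivrMr //; apply: lt_le_trans (archi_boundP _) _.
    by rewrite divr_ge0 // ltW.
  by rewrite ler_nat.
pose L := (N * #|B|)%N.
exists (TM_of_amachine (machine M L b0)), (c.*2 + (overhead B).*2)%N, d.+2 => A /= BA.
have [h [f [Mrun Mout [_ happ]]]] := alg A I.
have cov0 : exists phi : {ffun 'I_L -> option B}, covers #|A| phi.
  (* Block 0 fits into [A] since [#|B| <= #|A|]. *)
  by exists (block b0 N 0); apply: block_covers; rewrite ?mul1n.
have [phi [F [cov best run_F out_F]]] := machine_correct b0 Mrun Mout cov0.
exists (patched h phi), F; split => //.
  apply: run_leq run_F; apply: leq_trans (steps_bound _ _ _) _.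
  exact: polynomial_bound.
split; first exact: patched_surjective cov.
move=> os0; rewrite ler_pdivlMr ?ltr0n //.
set os := opt _ A in os0 *.
have oso : (os <= opt (max_csp B) A)%N.
  by apply/bigmax_leqP => g _; apply: csp_value_opt.
have [AL|LA] := leqP #|A| L.
  (* Every surjection is a patch here, so the output is optimal, and [r - e <= 1]. *)
  have osv : (os <= csp_value (patched h phi))%N.
    apply/bigmax_leqP => g gs; have [psi cpsi <-] := patched_all b0 h AL gs.
    exact: best.
  apply: le_trans (_ : os%:R <= _); last by rewrite ler_nat.
  by rewrite ler_piMl // ; case/andP: hr => _ r1; lra.
apply: (approx_arith e0 KN os0 oso (csp_value_opt (P := max_csp B) (g := h) isT)).
  have o0 : (0 < opt (max_csp B) A)%N := leq_trans os0 oso.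
  by rewrite -ler_pdivlMr ?ltr0n // happ.
(* All [N] blocks fit into [A], so the chosen patch is at least as good as each of them. *)
apply: (block_average (b0 := b0)) => j; apply: best; apply: block_covers => //.
by apply: leq_trans (ltnW LA); rewrite leq_mul2r ltn_ord orbT.
Qed.
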